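(* Let $d\ge1$ and let $G_t$ be the fundamental solution of the heat equation or of the wave equation on $\mathbb R^d$. Suppose that Dalang's condition $\int_{\mathbb R^d}\frac1{1+|\xi|^2}\mu(d\xi)<\infty$ holds. Then: (B') for any $t>0$, $K(t):=\sup_{\eta\in\mathbb R^d}\int_{\mathbb R^d}|\mathcal FG_t(\xi+\eta)|^2\mu(d\xi)<\infty$; (D') the map $(t,\xi)\mapsto\mathcal FG_t(\xi)$ is measurable on $\mathbb R_+\times\mathbb R^d$, and $$A_T:=\int_0^T\sup_{\eta\in\mathbb R^d}\int_{\mathbb R^d}|\mathcal FG_t(\xi+\eta)|^2\mu(d\xi)dt<\infty\quad\text{for any }T>0.$$
   Context: $\mathcal F\varphi(\xi)=\int e^{-i\xi\cdot x}\varphi(x)dx$, extended to tempered distributions. A measurable function $g$ is tempered if $\int(1+|x|^2)^{-\ell}|g(x)|dx<\infty$ for some $\ell>0$. $\kappa:\mathbb R^d\to[0,\infty]$ is a tempered function such that (a) its Fourier transform $h=\mathcal F\kappa$ (as a tempered distribution) is a tempered function; (b) $|h|^2$ is a tempered function; (c) there is a tempered function $f:\mathbb R^d\to[0,\infty]$ with $|h|^2=\mathcal Ff$ in $\mathcal S'(\mathbb R^d)$. Let $\mu(d\xi)=(2\pi)^{-d}|\mathcal F\kappa(\xi)|^2d\xi$. Fundamental solutions: heat ($\frac{\partial}{\partial t}-\frac12\Delta$): $\mathcal FG_t(\xi)=e^{-t|\xi|^2/2}$; wave ($\frac{\partial^2}{\partial t^2}-\Delta$): $\mathcal FG_t(\xi)=\sin(t|\xi|)/|\xi|$.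 *)

(* Defs.v *)
From HB Require Import structures.
From mathcomp Require Import all_boot all_order all_algebra.
From mathcomp Require Import all_classical all_reals all_analysis.
From mathcomp Require Import measurable_realfun.
From mathcomp Require Import complex.

Set Implicit Arguments.
Unset Strict Implicit.
Unset Printing Implicit Defensive.

Import Order.TTheory GRing.Theory Num.Theory.
Import numFieldNormedType.Exports.

Local Open Scope classical_set_scope.
Local Open Scope ring_scope.

(* 'rV[R]_d carries the product sigma-algebra of d copies of the Borel
   sigma-algebra of R, that is the Borel sigma-algebra of R^d; this mirrors the
   library's instance on d.-tuple R. *)
Section measurable_rV.
Context {R : realType} (d : nat).

Let coord : 'I_d -> 'rV[R]_d -> R := fun i x => x ord0 i.

Let rV_set0 : g_sigma_preimage coord set0.
Proof. exact: sigma_algebra0. Qed.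

Let rV_setC A : g_sigma_preimage coord A -> g_sigma_preimage coord (~` A).
Proof. exact: sigma_algebraC. Qed.

Let rV_bigcup (F : (set 'rV[R]_d)^nat) :
  (forall i, g_sigma_preimage coord (F i)) ->
  g_sigma_preimage coord (\bigcup_i (F i)).
Proof. exact: sigma_algebra_bigcup. Qed.

HB.instance Definition _ := @isMeasurable.Build default_measure_display
  'rV[R]_d (g_sigma_preimage coord) rV_set0 rV_setC rV_bigcup.

Lemma measurable_coord (i : 'I_d) :
  measurable_fun [set: 'rV[R]_d] (fun x : 'rV[R]_d => x ord0 i).
Proof.
move=> _ Y mY; rewrite setTI; apply: sub_sigma_algebra => /=.
rewrite -bigcup_seq/=; exists i => /=; first by rewrite mem_index_enum.
by exists Y => //; rewrite setTI.
Qed.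

Lemma measurable_fun_rVP d' (T : measurableType d') (f : T -> 'rV[R]_d) :
  measurable_fun setT f <->
  forall i, measurable_fun setT (fun t => f t ord0 i).
Proof.
split=> [mf i|mf]; first exact: (measurableT_comp (measurable_coord i) mf).
apply: (@measurability _ _ _ _ _ _ (\big[setU/set0]_(i < d)
    preimage_set_system setT (coord i) measurable)) => //.
move=> _ [B + <-]; rewrite -bigcup_seq/= => -[i _ [A mA <-]].
by rewrite !setTI; have := mf i measurableT A mA; rewrite setTI.
Qed.

End measurable_rV.

Definition rV_cons {R : realType} d (p : R * 'rV[R]_d) : 'rV[R]_d.+1 :=
  row_mx p.1%:M p.2.

Definition rV_uncons {R : realType} d (x : 'rV[R]_d.+1) : R * 'rV[R]_d :=
  (x ord0 ord0, rsubmx (x : 'rV[R]_(1 + d))).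

Lemma rV_consK {R : realType} d : cancel (@rV_cons R d) (@rV_uncons R d).
Proof.
move=> [a x]; rewrite /rV_uncons /rV_cons/=; congr pair; last exact: row_mxKr.
have -> : ord0 = @lshift 1 d ord0 :> 'I_d.+1 by exact: val_inj.
by rewrite [LHS]row_mxEl mxE.
Qed.

Lemma measurable_rV_cons {R : realType} d :
  measurable_fun setT (@rV_cons R d).
Proof.
apply/measurable_fun_rVP => i; rewrite /rV_cons.
case: (@split_ordP 1 d i) => j ->.
  rewrite (_ : (fun _ => _) = fst); first exact: measurable_fst.
  by apply/funext => p; rewrite [LHS]row_mxEl !ord1 mxE mulr1n.
rewrite (_ : (fun _ => _) = (fun x : 'rV[R]_d => x ord0 j) \o snd).
  exact: (measurableT_comp (measurable_coord j) measurable_snd).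
by apply/funext => p; rewrite [LHS]row_mxEr.
Qed.

Lemma measurable_rV_uncons {R : realType} d :
  measurable_fun setT (@rV_uncons R d).
Proof.
apply/measurable_fun_pairP; split; first exact: measurable_coord.
apply/measurable_fun_rVP => i /=.
under eq_fun do rewrite mxE.
exact: measurable_coord.
Qed.

Section lebesgue_rV_step.
Local Open Scope ereal_scope.
Context {R : realType} (d : nat).
Variable m : {sigma_finite_measure set 'rV[R]_d -> \bar R}.

Definition leb_step : set 'rV[R]_d.+1 -> \bar R :=
  pushforward (@lebesgue_measure R \x m) (@rV_cons R d).

HB.instance Definition _ := Measure.copy leb_step
  (measure_function_pushforward__canonical__measure_function_Measure
     (lebesgue_measure \x m) (@measurable_rV_cons R d)).

Let leb_step_sigma_finite : sigma_finite setT leb_step.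
Proof.
have /sigma_finiteP[F [TF ndF Foo]] := sigma_finiteT (@lebesgue_measure R).
have /sigma_finiteP[G [TG ndG Goo]] := sigma_finiteT m.
exists (fun n => @rV_uncons R d @^-1` (F n `*` G n)).
  apply/esym; rewrite -subTset => x _.
  have [n _ Fn] : (\bigcup_n F n) (rV_uncons x).1 by rewrite -TF.
  have [k _ Gk] : (\bigcup_n G n) (rV_uncons x).2 by rewrite -TG.
  exists (maxn n k) => //; split.
    by move: Fn; exact/subsetPset/ndF/leq_maxl.
  by move: Gk; exact/subsetPset/ndG/leq_maxr.
move=> n; have [mF Fn] := Foo n; have [mG Gn] := Goo n; split.
  rewrite -[X in measurable X]setTI.
  by apply: measurable_rV_uncons => //; exact: measurableX.
rewrite /leb_step /pushforward -comp_preimage.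
rewrite (_ : _ \o _ = id); last by apply/funext => x /=; rewrite rV_consK.
by rewrite preimage_id product_measure1E// lte_mul_pinfty// ge0_fin_numE.
Qed.

HB.instance Definition _ :=
  Measure_isSigmaFinite.Build _ _ _ leb_step leb_step_sigma_finite.

End lebesgue_rV_step.

(* d-dimensional Lebesgue measure, as the d-fold product of the Lebesgue
   measure of R *)
Fixpoint lebesgue_rV {R : realType} d :
    {sigma_finite_measure set 'rV[R]_d -> \bar R} :=
  if d is d'.+1 then leb_step (lebesgue_rV d') else \d_(0 : 'rV[R]_0).

Section euclidean.
Context {R : realType} (d : nat).
Implicit Types x y : 'rV[R]_d.

Definition dotp x y : R := \sum_(i < d) x ord0 i * y ord0 i.

(* Euclidean norm; the library norm `|x| on 'rV[R]_d is the sup norm *)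
Definition enorm x : R := Num.sqrt (dotp x x).

End euclidean.

Section schwartz.
Context {R : realType} (d : nat).

(* [:: i1; ...; ik] stands for the differential operator d_i1 ... d_ik *)
Definition partials (s : seq 'I_d) (u : 'rV[R]_d -> R) : 'rV[R]_d -> R :=
  foldr (fun i v => 'D_(delta_mx ord0 i) v) u s.

Definition smooth (u : 'rV[R]_d -> R) : Prop :=
  forall (s : seq 'I_d) (x : 'rV[R]_d), differentiable (partials s u) x.

Definition rapidly_decreasing (u : 'rV[R]_d -> R) : Prop :=
  forall (s : seq 'I_d) (k : nat), exists C : R, forall x : 'rV[R]_d,
    (1 + enorm x ^+ 2) ^+ k * `|partials s u x| <= C.

(* complex-valued Schwartz functions *)
Definition schwartz (phi : 'rV[R]_d -> R[i]) : Prop :=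
  [/\ smooth (fun x => complex.Re (phi x)),
      smooth (fun x => complex.Im (phi x)),
      rapidly_decreasing (fun x => complex.Re (phi x))
    & rapidly_decreasing (fun x => complex.Im (phi x))].

End schwartz.

Section fourier.
Context {R : realType} (d : nat).

(* integral over R^d of a complex-valued integrable function *)
Definition cintegral (f : 'rV[R]_d -> R[i]) : R[i] :=
  Complex (\int[lebesgue_rV d]_x complex.Re (f x))
          (\int[lebesgue_rV d]_x complex.Im (f x)).

Definition expi (theta : R) : R[i] := Complex (cos theta) (sin theta).

Definition fourier (phi : 'rV[R]_d -> R[i]) (xi : 'rV[R]_d) : R[i] :=
  cintegral (fun x => expi (- dotp xi x) * phi x).

(* Functionals on test functions; equality in S' is agreement on S, so the
   values outside S are irrelevant *)
Definition functional := ('rV[R]_d -> R[i]) -> R[i].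

Definition eq_tempered_dist (S T : functional) : Prop :=
  forall phi, schwartz phi -> S phi = T phi.

Definition fourier_dist (T : functional) : functional :=
  fun phi => T (fourier phi).

(* phi |-> int h phi, for h with values in the complex numbers *)
Definition dist_of_cfun (h : 'rV[R]_d -> R[i]) : functional :=
  fun phi => cintegral (fun x => h x * phi x).

(* phi |-> int g phi, for g with values in the extended reals *)
Definition dist_of_efun (g : 'rV[R]_d -> \bar R) : functional :=
  fun phi => Complex
    (fine (\int[lebesgue_rV d]_x (g x * (complex.Re (phi x))%:E))%E)
    (fine (\int[lebesgue_rV d]_x (g x * (complex.Im (phi x))%:E))%E).

Definition tempered (g : 'rV[R]_d -> \bar R) : Prop :=
  measurable_fun setT g /\
  exists2 l : R, 0 < l &
    (\int[lebesgue_rV d]_x (((1 + enorm x ^+ 2) `^ (- l))%:E * `|g x|)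
      < +oo)%E.

Definition ctempered (h : 'rV[R]_d -> R[i]) : Prop :=
  [/\ measurable_fun setT (fun x => complex.Re (h x)),
      measurable_fun setT (fun x => complex.Im (h x))
    & tempered (fun x => (ComplexField.Normc.normc (h x))%:E)].

(* mu(d xi) = (2 pi)^{-d} |h(xi)|^2 d xi *)
Definition spectral_measure (h : 'rV[R]_d -> R[i]) : set 'rV[R]_d -> \bar R :=
  fun A => (\int[lebesgue_rV d]_(xi in A)
    ((2 * pi) ^- d * ComplexField.Normc.normc (h xi) ^+ 2)%:E)%E.

End fourier.

(* d/dt - (1/2) Laplacian and d^2/dt^2 - Laplacian *)
Inductive evolution_operator := heat | wave.

(* The Fourier transform in space of the fundamental solution G_t. For d >= 4
   the wave kernel is only a distribution, so G_t is given through F G_t, which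
   is a function. At xi = 0 the wave symbol sin(t|xi|)/|xi| is its continuous
   extension, t. *)
Definition fundamental_solution_fourier {R : realType} d
    (op : evolution_operator) (t : R) (xi : 'rV[R]_d) : R :=
  match op with
  | heat => expR (- (t * enorm xi ^+ 2 / 2))
  | wave => if xi == 0 then t else sin (t * enorm xi) / enorm xi
  end.

(* sup_eta int |F G_t(xi + eta)|^2 mu(d xi) *)
Definition sup_shifted_energy {R : realType} d (op : evolution_operator)
    (mu : set 'rV[R]_d -> \bar R) (t : R) : \bar R :=
  ereal_sup (range (fun eta : 'rV[R]_d =>
    (\int[mu]_xi
      (`|fundamental_solution_fourier op t (xi + eta)| ^+ 2)%:E)%E)).

(* Main.v *)
(* A nonnegative f has the positivity property that, for every Gaussian
   g_s(x) = exp(- s |x|^2), the map m |-> int |h(x)|^2 g_s(x - m) dx is maximal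
   at m = 0: testing |h|^2 = F f against g_s(. - m) gives
   int f(x) cos(x.m) F g_s(x) dx, and F g_s >= 0.  Writing
   (1 + r)^-1 = int_0^oo exp(- u) exp(- u r) du and using Tonelli, the same
   maximality holds for the resolvent (1 + |.|^2)^-1, whose value at m = 0 is
   Dalang's integral.  The squared wave symbol is at most
   (1 + t^2) / (1 + |xi|^2).  The squared heat symbol is itself a Gaussian, and
   1 <= exp T * exp (- t) on [0, T] bounds the time integral by
   exp T times Dalang's integral. *)
From HB Require Import structures.
Require Import Defs.
From mathcomp Require Import all_boot all_order all_algebra.
From mathcomp Require Import all_classical all_reals all_analysis.
From mathcomp Require Import measurable_realfun.
From mathcomp Require Import complex.
From mathcomp Require Import ring lra.
Import Order.TTheory GRing.Theory Num.Theory.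
Import numFieldNormedType.Exports.
Local Open Scope classical_set_scope.
Local Open Scope ring_scope.
Set Implicit Arguments.
Unset Strict Implicit.
Unset Printing Implicit Defensive.

(** The resolvent decays too slowly to be a Schwartz function, so the identity |h|^2 = F f cannot be
    tested on it directly. Translated Gaussians can be tested, and their Fourier transforms are
    explicit; this is why maximality at m = 0 is proved for them first and then passed to the
    resolvent by mixing over s. For the heat symbol at a fixed time t, a pointwise comparison with
    the resolvent costs a factor 1 + 1/t. That suffices for (B') but is not integrable at t = 0, so
    (D') goes back to the mixture, whose s-integral is itself a weighted time integral of heat
    energies. *)

(** * Elementary inequalities for the Euclidean norm and the exponential *)

Lemma dotp_ge0 (R : realType) d (x : 'rV[R]_d) : 0 <= dotp x x.
Proof. by apply: sumr_ge0 => i _; rewrite -expr2 sqr_ge0. Qed.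

Lemma enorm_sqr (R : realType) d (x : 'rV[R]_d) : enorm x ^+ 2 = dotp x x.
Proof. by rewrite /enorm sqr_sqrtr// dotp_ge0. Qed.

Lemma normr_coord_le (R : realType) d (x : 'rV[R]_d) i :
  `|x ord0 i| <= 1 + dotp x x.
Proof.
apply: (@le_trans _ _ (1 + x ord0 i ^+ 2)).
  rewrite -real_normK ?num_real//; have := normr_ge0 (x ord0 i); nra.
rewrite lerD2l /dotp (bigD1 i)//= -expr2 lerDl.
by apply: sumr_ge0 => j _; rewrite -expr2 sqr_ge0.
Qed.

(** A Peetre-type inequality, from |a + b|^2 <= 2 |a|^2 + 2 |b|^2: it moves a polynomial weight from
    the origin to the centre m at the cost of a constant depending on m only. *)
Lemma dotp_shift_le (R : realType) d (x m : 'rV[R]_d) :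
  1 + dotp x x <= 2 * (1 + dotp m m) * (1 + dotp (x - m) (x - m)).
Proof.
have h : dotp x x <= 2 * dotp (x - m) (x - m) + 2 * dotp m m.
  rewrite /dotp !mulr_sumr -big_split/=; apply: ler_sum => i _.
  rewrite !mxE; have := sqr_ge0 (x ord0 i - 2 * m ord0 i); nra.
have := dotp_ge0 (x - m); have := dotp_ge0 m; nra.
Qed.

(** After taking k-th roots the claim is 1 + r <= a exp(s r / k) with a = 1 + k / s. It follows from
    exp(y) >= 1 + y, because a (1 + s r / k) contains both 1 and r among its nonnegative terms. The
    case k = 0 has no root to take and is separate. *)
Lemma poly_exp_bounded (R : realType) (s : R) (k : nat) : 0 < s ->
  exists2 C : R, 0 <= C & forall r, 0 <= r -> (1 + r) ^+ k * expR (- (s * r)) <= C.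
Proof.
move=> s0; pose a := 1 + k%:R / s.
have a0 : 0 <= a by rewrite addr_ge0// divr_ge0// ltW.
exists (a ^+ k) => [|r r0]; first by rewrite exprn_ge0.
case: k @a a0 => [|k] a a0.
  by rewrite !expr0 mul1r -expR0 ler_expR oppr_le0 mulr_ge0// ltW.
have -> : expR (- (s * r)) = expR (- (s * r / k.+1%:R)) ^+ k.+1.
  by rewrite -expRM_natr mulNr divfK.
rewrite -exprMn lerXn2r// ?nnegrE// ?mulr_ge0 ?expR_ge0 ?addr_ge0//.
rewrite expRN ler_pdivrMr ?expR_gt0//.
apply: (@le_trans _ _ (a * (1 + s * r / k.+1%:R))); last first.
  by rewrite ler_wpM2l// expR_ge1Dx.
have -> : a * (1 + s * r / k.+1%:R) = 1 + r + (k.+1%:R / s + s * r / k.+1%:R).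
  by rewrite /a; field; rewrite nat1r pnatr_eq0/= gt_eqF.
by rewrite lerDl addr_ge0// divr_ge0// ?mulr_ge0// ltW.
Qed.

(** * Translated Gaussians are Schwartz functions *)

Section gaussian.
Context {R : realType} {d : nat}.
Implicit Types (x m v : 'rV[R]_d) (P Q : 'rV[R]_d -> R).

Definition gaussian (s : R) m x := expR (- (s * dotp (x - m) (x - m))).

(** Only stability under directional derivatives and polynomial growth are required of these
    factors, and both follow by induction on this predicate. *)
Inductive polynomial_fun : ('rV[R]_d -> R) -> Prop :=
| polynomial_cst (c : R) : polynomial_fun (cst c)
| polynomial_coord (i : 'I_d) : polynomial_fun (fun x => x ord0 i)
| polynomialD P Q : polynomial_fun P -> polynomial_fun Q -> polynomial_fun (P + Q)
| polynomialM P Q : polynomial_fun P -> polynomial_fun Q -> polynomial_fun (P * Q).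

Lemma is_derive_coord x v (i : 'I_d) :
  is_derive x v (fun y => y ord0 i) (v ord0 i).
Proof.
have df : differentiable (fun y : 'rV[R]_d => y ord0 i : R) x.
  exact: differentiable_coord.
apply: DeriveDef; first exact: diff_derivable.
rewrite deriveE//.
have lf : linear (fun y : 'rV[R]_d => y ord0 i : R^o).
  by move=> a y z; rewrite !mxE.
pose f := GRing.isLinear.Build _ _ _ _ _ lf.
pose g : {linear _ -> _} := HB.pack (fun y : 'rV[R]_d => y ord0 i : R^o) f.
by rewrite (@diff_lin _ _ _ g)//; exact: coord_continuous.
Qed.

Lemma polynomial_differentiable P x : polynomial_fun P -> differentiable P x.
Proof.
elim=> {P}[c|i|P Q _ dP _ dQ|P Q _ dP _ dQ].
- exact: differentiable_cst.
- exact: differentiable_coord.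
- exact: differentiableD.
- exact: differentiableM.
Qed.

Lemma polynomial_derive P v : polynomial_fun P -> polynomial_fun ('D_v P).
Proof.
elim=> {P}[c|i|P Q pP dP pQ dQ|P Q pP dP pQ dQ].
- rewrite (_ : 'D_v _ = cst 0); first exact: polynomial_cst.
  by apply/funext => x; rewrite derive_cst.
- rewrite (_ : 'D_v _ = cst (v ord0 i)); first exact: polynomial_cst.
  by apply/funext => x; have /@derive_val := is_derive_coord x v i.
- rewrite (_ : 'D_v _ = 'D_v P + 'D_v Q); first exact: polynomialD.
  by apply/funext => x; rewrite deriveD//; apply: diff_derivable;
    exact: polynomial_differentiable.
- rewrite (_ : 'D_v _ = P * 'D_v Q + Q * 'D_v P).
    by apply: polynomialD; exact: polynomialM.
  by apply/funext => x; rewrite deriveM//; apply: diff_derivable;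
    exact: polynomial_differentiable.
Qed.

Lemma polynomial_bounded P : polynomial_fun P ->
  exists (C : R) (k : nat), forall x, `|P x| <= C * (1 + dotp x x) ^+ k.
Proof.
elim=> {P}[c|i|P Q _ [C [k hP]] _ [D [l hQ]]|P Q _ [C [k hP]] _ [D [l hQ]]].
- by exists `|c|, 0%N => x; rewrite expr0 mulr1.
- by exists 1, 1%N => x; rewrite mul1r expr1 normr_coord_le.
- have n1 x : 1 <= 1 + dotp x x by rewrite lerDl dotp_ge0.
  exists (`|C| + `|D|), (maxn k l) => x.
  rewrite (le_trans (ler_normD _ _))// mulrDl lerD//.
    rewrite (le_trans (hP x))// (le_trans (ler_norm _))// normrM.
    rewrite ler_wpM2l// ger0_norm ?exprn_ge0// ?addr_ge0 ?dotp_ge0//.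
    by rewrite ler_weXn2l// leq_maxl.
  rewrite (le_trans (hQ x))// (le_trans (ler_norm _))// normrM.
  rewrite ler_wpM2l// ger0_norm ?exprn_ge0// ?addr_ge0 ?dotp_ge0//.
  by rewrite ler_weXn2l// leq_maxr.
- exists (C * D), (k + l)%N => x.
  by rewrite normrM exprD mulrACA ler_pM.
Qed.

Lemma dotp_shift_polynomial m : polynomial_fun (fun x => dotp (x - m) (x - m)).
Proof.
rewrite (_ : (fun _ => _) = \sum_(i < d)
   (((fun x => x ord0 i) + cst (- m ord0 i)) * ((fun x => x ord0 i) + cst (- m ord0 i)))).
  elim/big_ind : _ => [||i _].
  - exact: (polynomial_cst 0).
  - exact: polynomialD.
  by apply: polynomialM; apply: polynomialD; solve
    [exact: polynomial_coord|exact: polynomial_cst].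
by apply/funext => x; rewrite fct_sumE; apply: eq_bigr => i _; rewrite !mxE.
Qed.

Lemma gaussian_differentiable s m x : differentiable (gaussian s m) x.
Proof.
apply: (@differentiable_comp _ _ _ _ (fun x => - (s * dotp (x - m) (x - m))) expR).
  apply: polynomial_differentiable.
  rewrite (_ : (fun _ => _) = cst (- s) * (fun x => dotp (x - m) (x - m))).
    by apply: polynomialM; [exact: polynomial_cst|exact: dotp_shift_polynomial].
  by apply/funext => y; exact: (esym (mulNr _ _)).
exact/derivable1_diffP.
Qed.

(** Chain rule: Q is the directional derivative of the quadratic exponent. *)
Lemma derive_gaussian s m v : exists2 Q, polynomial_fun Q &
  'D_v (gaussian s m) = Q * gaussian s m.
Proof.
pose q : 'rV[R]_d -> R := fun x => - (s * dotp (x - m) (x - m)).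
have pq : polynomial_fun q.
  rewrite (_ : q = cst (- s) * (fun x => dotp (x - m) (x - m))).
    by apply: polynomialM; [exact: polynomial_cst|exact: dotp_shift_polynomial].
  by apply/funext => y; exact: (esym (mulNr _ _)).
exists ('D_v q); first exact: polynomial_derive.
apply/funext => x; rewrite deriveE; last exact: gaussian_differentiable.
rewrite (_ : gaussian s m = expR \o q)// diff_comp//=; last 2 first.
  exact: polynomial_differentiable.
  exact/derivable1_diffP.
rewrite diff1E/=; last exact/derivable1_diffP.
rewrite -deriveE; last exact: polynomial_differentiable.
rewrite derive1E.
have /@derive_val -> := is_derive_expR (q x).
by [].
Qed.

(** The products of a polynomial and a fixed Gaussian form a class closed under differentiation,
    which handles iterated partial derivatives of every order at once. *)
Lemma partials_gaussian s m P (l : seq 'I_d) : polynomial_fun P ->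
  exists2 Q, polynomial_fun Q & partials l (P * gaussian s m) = Q * gaussian s m.
Proof.
move=> pP; elim: l => [|i l [Q pQ /= ->]]; first by exists P.
have [G pG dG] := derive_gaussian s m (delta_mx ord0 i).
exists (Q * G + 'D_(delta_mx ord0 i) Q).
  by apply: polynomialD; [exact: polynomialM|exact: polynomial_derive].
apply/funext => x; rewrite deriveM; last 2 first.
- by apply: diff_derivable; exact: polynomial_differentiable.
- by apply: diff_derivable; exact: gaussian_differentiable.
have /= -> := congr1 (@^~ x) dG.
rewrite /GRing.scale/= !fctE.
by ring.
Qed.

Lemma gaussian_smooth s m : smooth (gaussian s m).
Proof.
move=> l x; rewrite -[gaussian s m]mul1r.
have [Q pQ ->] := partials_gaussian s m l (polynomial_cst 1).
apply: differentiableM; first exact: polynomial_differentiable.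
exact: gaussian_differentiable.
Qed.

(** The weight is centred at 0 and the Gaussian at m; [dotp_shift_le] recentres the weight, after
    which the bound is a one-variable one in r = |x - m|^2. *)
Lemma polynomial_gaussian_bounded s m (k : nat) : 0 < s ->
  exists2 C : R, 0 <= C & forall x, (1 + dotp x x) ^+ k * gaussian s m x <= C.
Proof.
move=> s0; have [C C0 hC] := poly_exp_bounded k s0.
exists ((2 * (1 + dotp m m)) ^+ k * C) => [|x].
  by rewrite mulr_ge0// exprn_ge0// mulr_ge0// addr_ge0// dotp_ge0.
apply: le_trans (ler_wpM2l _ (hC _ (dotp_ge0 (x - m)))); last first.
  by rewrite exprn_ge0// mulr_ge0// addr_ge0// dotp_ge0.
rewrite mulrA ler_wpM2r ?expR_ge0// -exprMn lerXn2r ?nnegrE ?dotp_shift_le//.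
  by rewrite addr_ge0// dotp_ge0.
by rewrite !mulr_ge0// addr_ge0// dotp_ge0.
Qed.

Lemma gaussian_rapidly_decreasing s m : 0 < s ->
  rapidly_decreasing (gaussian s m).
Proof.
move=> s0 l k; rewrite -[gaussian s m]mul1r.
have [Q pQ ->] := partials_gaussian s m l (polynomial_cst 1).
have [C [n hQ]] := polynomial_bounded pQ.
(* The exponent n pays for the growth of the polynomial factor [Q], the exponent k for the weight in
   the definition of rapid decrease. *)
have [D D0 hD] := polynomial_gaussian_bounded m (k + n) s0.
exists (`|C| * D) => x; rewrite enorm_sqr normrM [`|gaussian _ _ _|]ger0_norm ?expR_ge0//.
apply: le_trans (ler_wpM2l (normr_ge0 C) (hD x)).
have n0 j : 0 <= (1 + dotp x x) ^+ j by rewrite exprn_ge0// addr_ge0// dotp_ge0.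
rewrite exprD -[in leRHS]mulrA [leRHS]mulrCA ler_wpM2l// mulrA ler_wpM2r ?expR_ge0//.
by rewrite (le_trans (hQ x))// ler_wpM2r ?ler_norm.
Qed.

Lemma schwartz_gaussian s m : 0 < s ->
  schwartz (fun x => (gaussian s m x)%:C%C).
Proof.
move=> s0.
have partials0 l : partials l (cst 0) = cst 0 :> ('rV[R]_d -> R).
  elim: l => [//|i l /= ->]; apply/funext => x; exact: derive_cst.
split; [exact: gaussian_smooth| |exact: gaussian_rapidly_decreasing|].
- by move=> l x; rewrite partials0; exact: differentiable_cst.
- by move=> l k; exists 0 => x; rewrite partials0/= normr0 mulr0.
Qed.

End gaussian.

(** * Fourier integral of the one-dimensional Gaussian *)

Lemma integrable_scale dd (T : measurableType dd) (R : realType)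
    (mu : {measure set T -> \bar R}) (k : R) (f : T -> R) :
  mu.-integrable setT (EFin \o f) -> mu.-integrable setT (fun x => (k * f x)%:E).
Proof. exact: (@integrableZl _ _ _ mu setT measurableT k). Qed.

Section gauss1.
Context {R : realType}.
Local Notation leb := (@lebesgue_measure R).
Implicit Types (s m x xi th : R).

Definition gauss1 s m x := expR (- (s * (x - m) ^+ 2)).

(** For s > 0 this is sqrt(pi / s): exp(- s (x - m)^2) is this multiple of the normal density with
    mean m and variance 1 / (2 s). *)
Definition gauss1_mass s : R := (normal_peak (Num.sqrt (s *+ 2)^-1))^-1.

Lemma gauss1_mass_ge0 s : 0 <= gauss1_mass s.
Proof. by rewrite invr_ge0 normal_peak_ge0. Qed.

Lemma gauss1_normal s m x : 0 < s ->
  gauss1 s m x = gauss1_mass s * normal_pdf m (Num.sqrt (s *+ 2)^-1) x.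
Proof.
move=> s0; set sg := Num.sqrt _.
have sg0 : 0 < sg by rewrite sqrtr_gt0 invr_gt0 pmulrn_lgt0.
rewrite normal_pdfE ?gt_eqF// /gauss1_mass -/sg mulKf; last first.
  by rewrite gt_eqF// normal_peak_gt0// gt_eqF.
rewrite /gauss1 /normal_fun sqr_sqrtr ?invr_ge0 ?pmulrn_lge0//; last exact: ltW.
congr expR; field; by rewrite gt_eqF.
Qed.

Lemma gauss1_ge0 s m x : 0 <= gauss1 s m x.
Proof. exact: expR_ge0. Qed.

Lemma integrable_gauss1 s m : 0 < s ->
  leb.-integrable setT (EFin \o gauss1 s m).
Proof.
move=> s0; rewrite (_ : _ \o _ = (fun x => (gauss1_mass s)%:E *
    (normal_pdf m (Num.sqrt (s *+ 2)^-1) x)%:E)%E).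
  by apply: integrableZl => //; exact: integrable_normal_pdf.
by apply/funext => x; rewrite /= gauss1_normal.
Qed.

Lemma Rintegral_gauss1 s m : 0 < s -> \int[leb]_x gauss1 s m x = gauss1_mass s.
Proof.
move=> s0; under eq_Rintegral do rewrite gauss1_normal//.
rewrite RintegralZl//; last exact: integrable_normal_pdf.
by rewrite /Rintegral integral_normal_pdf mulr1.
Qed.

Lemma continuous_gauss1 s m : continuous (gauss1 s m).
Proof.
move=> x; apply: differentiable_continuous; apply/derivable1_diffP.
exact: ex_derive.
Qed.

(** Half of the exponent absorbs the factor |x - m|, the other half stays integrable. The right-hand
    side later dominates the derivative in the frequency, for all frequencies at once. *)
Lemma gauss1_moment s m : 0 < s ->
  exists2 C, 0 <= C & forall x, `|x - m| * gauss1 s m x <= C * gauss1 (s / 2) m x.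
Proof.
move=> s0; have s20 : 0 < s / 2 by rewrite divr_gt0.
have [C C0 hC] := poly_exp_bounded 1 s20.
exists C => // y; rewrite /gauss1.
rewrite (_ : - (s * (y - m) ^+ 2) = - (s / 2 * (y - m) ^+ 2) + - (s / 2 * (y - m) ^+ 2)); last by field.
rewrite expRD mulrA ler_wpM2r ?expR_ge0//.
apply: le_trans (hC _ (sqr_ge0 (y - m))); rewrite expr1 ler_wpM2r ?expR_ge0//.
rewrite -real_normK ?num_real//; have := normr_ge0 (y - m); nra.
Qed.

(** Integration by parts without boundary terms: on a growing interval the integral is a difference
    of boundary values of [H], which the Gaussian bound sends to 0, while dominated convergence
    recovers the full integral. *)
Lemma Rintegral_derive_eq0 s m (H h : R -> R) : 0 < s ->
  (forall x, is_derive x 1 H (h x)) -> continuous h ->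
  leb.-integrable setT (EFin \o h) -> (forall x, `|H x| <= gauss1 s m x) ->
  \int[leb]_x h x = 0.
Proof.
move=> s0 dH ch ih Hg.
(* The successor keeps the interval nondegenerate at n = 0, as the fundamental theorem of calculus
   demands. *)
pose J n : set R := `[m - n.+1%:R, m + n.+1%:R]%classic.
have mh : measurable_fun setT (EFin \o h) := measurable_int _ ih.
have [||||| _ _ cvh] := @dominated_convergence _ _ _ leb setT measurableT
  (fun n => (EFin \o h) \_ (J n)) (EFin \o h) (abse \o (EFin \o h)).
- move=> n; apply: (measurable_restrictT _ _).1; [exact: measurable_itv|exact: measurable_funS mh].
- exact: mh.
- apply: aeW => x _; apply: cvg_near_cst.
  near=> n.
  rewrite patchE ifT// inE /J/= in_itv/=.
  have : `|x - m| <= n%:R by near: n; exact: nbhs_infty_ger.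
  rewrite ler_norml -natr1 => /andP[? ?]; apply/andP; split; lra.
- exact: integrable_abse.
- apply: aeW => x n _; rewrite patchE; case: ifPn => _ //=.
  by rewrite normr0 lee_fin.
have JE n : (\int[leb]_x ((EFin \o h) \_ (J n)) x)%E =
    (H (m + n.+1%:R) - H (m - n.+1%:R))%:E.
  rewrite -integral_mkcond (@continuous_FTC2 _ h H)//.
  - by rewrite ltrD2l gtrN.
  - by apply: continuous_subspaceT => x; exact: ch.
  - have cH x : H x @[x --> x] --> H x.
      by apply: differentiable_continuous; apply/derivable1_diffP.
    split.
    + by move=> x _; exact: ex_derive.
    + by apply: cvg_at_right_filter; exact: cH.
    + by apply: cvg_at_left_filter; exact: cH.
  - by move=> x _; rewrite derive1E; exact: derive_val.
have cv0 : (fun n => (H (m + n.+1%:R) - H (m - n.+1%:R))%:E) @ \oo --> 0%:E.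
  apply: cvg_EFin; first exact: nearW.
  rewrite /comp/=.
  (* Each boundary value is at most exp(- s (n + 1)^2) <= q ^ n, because (n + 1)^2 >= n, and q <
     1. *)
  pose q := expR (- s).
  have cq : 2 * q ^+ n @[n --> \oo] --> 0.
    rewrite -(mulr0 2); apply: cvgMr; apply: cvg_expr.
    by rewrite ger0_norm ?expR_ge0// expR_lt1 oppr_lt0.
  apply/norm_cvg0P; apply: (@squeeze_cvgr _ _ _ _ (cst 0) _ _ _ _ _ cq); last exact: cvg_cst.
  apply: nearW => n; rewrite /= normr_ge0/=.
  rewrite (le_trans (ler_normB _ _))// mulr_natl mulr2n lerD//.
    rewrite (le_trans (Hg _))// /gauss1 /q -expRM_natr ler_expR.
    rewrite addrAC subrr add0r -natr1 mulNr lerN2 ler_wpM2l ?ltW//.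
    have := ler0n R n; nra.
  rewrite (le_trans (Hg _))// /gauss1 /q -expRM_natr ler_expR.
  rewrite addrAC subrr add0r sqrrN -natr1 mulNr lerN2 ler_wpM2l ?ltW//.
  have := ler0n R n; nra.
have {}cvh : (H (m + n.+1%:R) - H (m - n.+1%:R))%:E @[n --> \oo]
    --> (\int[leb]_x (h x)%:E)%E by rewrite -(funext JE).
by rewrite /Rintegral (cvg_unique _ cvh cv0).
Unshelve. all: end_near. Qed.

Lemma integrable_mul_gauss1 s m (u : R -> R) : 0 < s ->
  measurable_fun setT u -> (forall x, `|u x| <= 1) ->
  leb.-integrable setT (fun x => (u x * gauss1 s m x)%:E).
Proof.
move=> s0 mu u1; apply: (le_integrable measurableT _ _ (integrable_gauss1 m s0)).
  apply/measurable_EFinP; apply: measurable_funM => //.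
  by apply: continuous_measurable_fun; exact: continuous_gauss1.
move=> x _; rewrite /= lee_fin normrM [leRHS]ger0_norm ?gauss1_ge0//.
by rewrite [`|gauss1 _ _ _|]ger0_norm ?gauss1_ge0// ler_piMl ?gauss1_ge0.
Qed.

Lemma measurable_cos_affine (a b c : R) :
  measurable_fun setT (fun x => cos (a + b * (x - c))).
Proof.
apply: continuous_measurable_fun => x; apply: differentiable_continuous.
by apply/derivable1_diffP; exact: ex_derive.
Qed.

Lemma normr_cos_le1 (x : R) : `|cos x| <= 1.
Proof. by rewrite ler_norml cos_geN1 cos_le1. Qed.

Lemma normr_sin_le1 (x : R) : `|sin x| <= 1.
Proof. by rewrite ler_norml sin_geN1 sin_le1. Qed.

(* As a function of xi the integral F solves 2 s F' = - xi F: differentiate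
   under the integral sign, then integrate by parts. The phase th absorbs the
   other coordinates in the induction on the dimension below. *)
Lemma Rintegral_cos_gauss1 s m th xi : 0 < s ->
  \int[leb]_x (cos (th + xi * (x - m)) * gauss1 s m x) =
  cos th * (gauss1_mass s * expR (- (xi ^+ 2 / (4 * s)))).
Proof.
move=> s0; have s20 : 0 < s / 2 by rewrite divr_gt0.
pose F z := \int[leb]_x (cos (th + z * (x - m)) * gauss1 s m x).
pose S z := \int[leb]_x ((x - m) * sin (th + z * (x - m)) * gauss1 s m x).
have [C C0 hC] := gauss1_moment m s0.
have msin z : measurable_fun setT (fun x => sin (th + z * (x - m))).
  apply: continuous_measurable_fun => x; apply: differentiable_continuous.
  by apply/derivable1_diffP; exact: ex_derive.
have iC z : leb.-integrable setT (EFin \o (fun x => cos (th + z * (x - m)) * gauss1 s m x)).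
  apply: integrable_mul_gauss1 => //; first exact: measurable_cos_affine.
  by move=> x; exact: normr_cos_le1.
have iG : leb.-integrable setT (EFin \o (fun x => C * gauss1 (s / 2) m x)).
  by apply: integrable_scale; exact: integrable_gauss1.
have iS z : leb.-integrable setT
    (EFin \o (fun x => (x - m) * sin (th + z * (x - m)) * gauss1 s m x)).
  apply: (le_integrable measurableT _ _ iG).
    apply/measurable_EFinP; apply: measurable_funM; last first.
      by apply: continuous_measurable_fun; exact: continuous_gauss1.
    apply: measurable_funM; last exact: msin.
    apply: continuous_measurable_fun => x; apply: differentiable_continuous.
    by apply/derivable1_diffP; exact: ex_derive.
  move=> x _; rewrite /= lee_fin (le_trans _ (ler_norm _))//.
  rewrite (le_trans _ (hC x))// !normrM [`|gauss1 _ _ _|]ger0_norm ?gauss1_ge0//.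
  by rewrite ler_wpM2r ?gauss1_ge0// ler_piMr// normr_sin_le1.
have dF (z : R) : is_derive z 1 F (- S z).
  pose f y x := cos (th + y * (x - m)) * gauss1 s m x.
  have df (y x : R) : is_derive y 1 (f ^~ x) (- ((x - m) * sin (th + y * (x - m)) * gauss1 s m x)).
    rewrite /f; apply: is_derive_eq; rewrite /GRing.scale/=; ring.
  have d1f (y x : R) : partial1of2 f y x = - ((x - m) * sin (th + y * (x - m)) * gauss1 s m x).
    by rewrite partial1of2E; exact: derive_val.
  have zI : [set` `]z - 1, z + 1[%R] z by rewrite /= in_itv/=; lra.
  have D1 y x : [set` `]z - 1, z + 1[%R] y -> setT x -> derivable (f ^~ x) y 1.
    by move=> _ _; exact: ex_derive.
  have G0 x : 0 <= C * gauss1 (s / 2) m x by rewrite mulr_ge0 ?gauss1_ge0.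
  have Gub y x : [set` `]z - 1, z + 1[%R] y -> setT x ->
      `|partial1of2 f y x| <= C * gauss1 (s / 2) m x.
    move=> _ _; rewrite d1f normrN.
    rewrite (le_trans _ (hC x))// !normrM [`|gauss1 _ _ _|]ger0_norm ?gauss1_ge0//.
    by rewrite ler_wpM2r ?gauss1_ge0// ler_piMr// normr_sin_le1.
  apply: DeriveDef.
    exact: (derivable_under_integral measurableT zI (fun y _ => iC y) D1 G0 iG Gub).
  rewrite -derive1E.
  rewrite (differentiation_under_integral measurableT zI (fun y _ => iC y) D1 G0 iG Gub).
  under eq_Rintegral do rewrite d1f -mulN1r.
  by rewrite RintegralZl// mulN1r.
have ibp z : z * F z = 2 * s * S z.
  apply/eqP; rewrite -subr_eq0; apply/eqP.
  rewrite -RintegralZl// -RintegralZl// -RintegralB//; last 2 first.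
    exact: integrable_scale (iC z).
    exact: integrable_scale (iS z).
  (* Differentiating the sine produces the integrand of z F z, and differentiating the Gaussian
     produces minus that of 2 s S z. *)
  apply: (@Rintegral_derive_eq0 s m (fun x => sin (th + z * (x - m)) * gauss1 s m x)) => //.
  - move=> x; rewrite /gauss1; apply: is_derive_eq; rewrite /GRing.scale/=; ring.
  - move=> x; apply: differentiable_continuous.
    by apply/derivable1_diffP; exact: ex_derive.
  - exact: (integrableB measurableT (integrable_scale z (iC z))
      (integrable_scale (2 * s) (iS z))).
  - move=> x; rewrite normrM [`|gauss1 _ _ _|]ger0_norm ?gauss1_ge0//.
    by rewrite ler_piMl ?gauss1_ge0// normr_sin_le1.
(* The integrating factor of 2 s F' = - z F: [K] is constant, and its value at 0 is the plain
   Gaussian mass times cos th. *)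
pose K z := F z * expR (z ^+ 2 / (4 * s)).
have dK (z : R) : is_derive z 1 K 0.
  apply: is_derive_eq; rewrite /GRing.scale/=.
  have -> : S z = z * F z / (2 * s) by rewrite ibp mulrC mulKf// mulf_neq0// gt_eqF.
  by field; rewrite gt_eqF.
have K0 : K 0 = cos th * gauss1_mass s.
  rewrite /K expr0n mul0r expR0 mulr1 /F.
  under eq_Rintegral do rewrite mul0r addr0.
  by rewrite RintegralZl ?Rintegral_gauss1//; exact: integrable_gauss1.
rewrite mulrA -K0 -(is_derive_0_is_cst xi 0 dK) /K -mulrA -expRD subrr expR0.
by rewrite mulr1.
Qed.

End gauss1.

(** * Measurability on R^d, and splitting off the first coordinate *)

Lemma measurable_dotp dd (T : measurableType dd) (R : realType) d
    (u v : T -> 'rV[R]_d) :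
  measurable_fun setT u -> measurable_fun setT v ->
  measurable_fun setT (fun t => dotp (u t) (v t)).
Proof.
move=> mu mv; apply: measurable_sum => i; apply: measurable_funM.
  exact: (measurable_fun_rVP u).1.
exact: (measurable_fun_rVP v).1.
Qed.

Lemma measurable_addr_rV (R : realType) d (m : 'rV[R]_d) :
  measurable_fun setT (fun x : 'rV[R]_d => x + m).
Proof.
apply/measurable_fun_rVP => i; under eq_fun do rewrite mxE.
apply: measurable_funD => //; exact: measurable_coord.
Qed.

Lemma measurable_gaussian (R : realType) d s (m : 'rV[R]_d) :
  measurable_fun setT (gaussian s m).
Proof.
apply: measurableT_comp => //; apply: measurable_funN.
apply: measurable_funM => //; apply: measurable_dotp;
  exact: (measurable_addr_rV (- m)).
Qed.

Lemma measurable_cos_dotp (R : realType) d th (xi m : 'rV[R]_d) :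
  measurable_fun setT (fun x : 'rV[R]_d => cos (th + dotp xi (x - m))).
Proof.
apply: (measurableT_comp (f := cos)).
  by apply: continuous_measurable_fun; exact: continuous_cos.
apply: measurable_funD => //; apply: measurable_dotp => //.
exact: (measurable_addr_rV (- m)).
Qed.

Lemma dotp_uncons (R : realType) d (y z : 'rV[R]_d.+1) :
  dotp y z = (rV_uncons y).1 * (rV_uncons z).1 +
    dotp (rV_uncons y).2 (rV_uncons z).2.
Proof.
rewrite /dotp big_ord_recl; congr (_ + _).
apply: eq_bigr => i _; rewrite !mxE.
by have -> : lift ord0 i = @rshift 1 d i :> 'I_d.+1 by exact: val_inj.
Qed.

Lemma dotp_cons (R : realType) d (p : R * 'rV[R]_d) (y : 'rV[R]_d.+1) :
  dotp y (rV_cons p) = (rV_uncons y).1 * p.1 + dotp (rV_uncons y).2 p.2.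
Proof. by rewrite dotp_uncons rV_consK. Qed.

Lemma rV_cons_sub (R : realType) d (p : R * 'rV[R]_d) (m : 'rV[R]_d.+1) :
  rV_cons p - m = rV_cons (p.1 - (rV_uncons m).1, p.2 - (rV_uncons m).2).
Proof.
apply/rowP => i; rewrite mxE /rV_cons /rV_uncons/=.
case: (@split_ordP 1 d i) => j ->.
  rewrite [X in X + _ = _]row_mxEl [RHS]row_mxEl !ord1 !mxE !mulr1n.
  by congr (_ - m _ _); exact: val_inj.
by rewrite [X in X + _ = _]row_mxEr [RHS]row_mxEr !mxE.
Qed.

Lemma gaussian_cons (R : realType) d s (p : R * 'rV[R]_d) (m : 'rV[R]_d.+1) :
  gaussian s m (rV_cons p) =
  gauss1 s (rV_uncons m).1 p.1 * gaussian s (rV_uncons m).2 p.2.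
Proof.
by rewrite /gaussian rV_cons_sub dotp_cons rV_consK/= mulrDr opprD expRD.
Qed.

(** [lebesgue_rV d.+1] is by definition the image of a product measure under [rV_cons], so a change
    of variables reduces this to Tonelli. *)
Lemma ge0_integral_lebesgue_rV_cons (R : realType) d (f : 'rV[R]_d.+1 -> \bar R) :
  measurable_fun setT f -> (forall x, 0 <= f x)%E ->
  (\int[lebesgue_rV d.+1]_x f x =
   \int[lebesgue_measure]_a \int[lebesgue_rV d]_x f (rV_cons (a, x)))%E.
Proof.
have mc : measurable_fun [set: measurableTypeR R * 'rV[R]_d] (@rV_cons R d).
  exact: measurable_rV_cons.
move=> mf f0.
rewrite (@ge0_integral_pushforward _ _ _ _ R _ mc
  (@lebesgue_measure R \x lebesgue_rV d)%E setT f)// preimage_setT.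
apply: (@fubini_tonelli1 _ _ (measurableTypeR R) 'rV[R]_d R
  (@lebesgue_measure R) (lebesgue_rV d) (f \o @rV_cons R d)) => [|x]; last exact: f0.
exact: measurableT_comp mf mc.
Qed.

Lemma integral_lebesgue_rV_cons (R : realType) d (f : 'rV[R]_d.+1 -> \bar R) :
  (lebesgue_rV d.+1).-integrable setT f ->
  (\int[lebesgue_rV d.+1]_x f x =
   \int[lebesgue_measure]_a \int[lebesgue_rV d]_x f (rV_cons (a, x)))%E.
Proof.
have mc : measurable_fun [set: measurableTypeR R * 'rV[R]_d] (@rV_cons R d).
  exact: measurable_rV_cons.
move=> /integrableP[mf fi].
have i2 : (@lebesgue_measure R \x lebesgue_rV d)%E.-integrable setT (f \o @rV_cons R d).
  apply/integrableP; split.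
    exact: (measurableT_comp mf (@measurable_rV_cons R d)).
  apply: le_lt_trans fi.
  rewrite (@ge0_integral_pushforward _ _ _ _ R _ mc
    (@lebesgue_measure R \x lebesgue_rV d)%E setT (abse \o f))//.
  - exact: measurableT_comp mf.
  - by move=> x _; exact: abse_ge0.
rewrite (@integral_pushforward _ _ _ _ R _ mc
  (@lebesgue_measure R \x lebesgue_rV d)%E setT f)//.
rewrite preimage_setT; apply/esym.
exact: (@integral12_prod_meas1 _ _ (measurableTypeR R) 'rV[R]_d R
  (@lebesgue_measure R) (lebesgue_rV d) (f \o @rV_cons R d)).
Qed.

(** * Fourier integral of the Gaussian in dimension d *)

Section gaussian_integral.
Context {R : realType}.

Lemma integral_gaussian d s (m : 'rV[R]_d) : 0 < s ->
  (\int[lebesgue_rV d]_x (gaussian s m x)%:E = (gauss1_mass s ^+ d)%:E)%E.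
Proof.
move=> s0; elim: d m => [|d IH] m.
  rewrite integral_dirac//; last by apply/measurable_EFinP; exact: measurable_gaussian.
  by rewrite diracT mul1e /gaussian /dotp big_ord0 mulr0 oppr0 expR0.
rewrite ge0_integral_lebesgue_rV_cons; last 2 first.
  by apply/measurable_EFinP; exact: measurable_gaussian.
  by move=> x; rewrite lee_fin expR_ge0.
transitivity (\int[lebesgue_measure]_a ((gauss1_mass s ^+ d)%:E * (gauss1 s (rV_uncons m).1 a)%:E))%E.
  apply: eq_integral => a _.
  transitivity (\int[lebesgue_rV d]_x ((gauss1 s (rV_uncons m).1 a)%:E *
      (gaussian s (rV_uncons m).2 x)%:E))%E.
    by apply: eq_integral => x _; rewrite gaussian_cons.
  rewrite ge0_integralZl ?IH 1?muleC//.
  - by apply/measurable_EFinP; exact: measurable_gaussian.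
  - by move=> x _; rewrite lee_fin expR_ge0.
  - by rewrite lee_fin gauss1_ge0.
have i1 := integrable_gauss1 (rV_uncons m).1 s0.
rewrite integralZl//.
rewrite -[X in (_ * X)%E]fineK; last exact: integrable_fin_num.
by rewrite -EFinM [fine _](Rintegral_gauss1 (rV_uncons m).1 s0) exprSr.
Qed.

Lemma integrable_gaussian d s (m : 'rV[R]_d) : 0 < s ->
  (lebesgue_rV d).-integrable setT (EFin \o gaussian s m).
Proof.
move=> s0; apply/integrableP; split.
  by apply/measurable_EFinP; exact: measurable_gaussian.
under eq_integral => x _ do rewrite /= ger0_norm ?expR_ge0//.
by rewrite integral_gaussian// ltry.
Qed.

Lemma integrable_cos_gaussian d s th (xi m : 'rV[R]_d) : 0 < s ->
  (lebesgue_rV d).-integrable setT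
    (fun x => (cos (th + dotp xi (x - m)) * gaussian s m x)%:E).
Proof.
move=> s0; apply: (le_integrable measurableT _ _ (integrable_gaussian m s0)).
  apply/measurable_EFinP; apply: measurable_funM.
    exact: measurable_cos_dotp.
  exact: measurable_gaussian.
move=> x _; rewrite /= lee_fin normrM ler_piMl//.
exact: normr_cos_le1.
Qed.

(** The phase must vary in the induction: once the first coordinate a is fixed, the inner integral
    is the same problem with phase th + xi_1 (a - m_1). Its value is a constant times the cosine of
    that phase, which leaves the one-dimensional integral over a. *)
Lemma integral_cos_gaussian d s th (xi m : 'rV[R]_d) : 0 < s ->
  (\int[lebesgue_rV d]_x (cos (th + dotp xi (x - m)) * gaussian s m x)%:E =
  (cos th * (gauss1_mass s ^+ d * expR (- (dotp xi xi / (4 * s)))))%:E)%E.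
Proof.
move=> s0; elim: d xi m th => [|d IH] xi m th.
  rewrite integral_dirac//; last first.
    by apply: measurable_int (integrable_cos_gaussian th xi m s0).
  by rewrite diracT mul1e /gaussian /dotp !big_ord0 addr0 mulr0 mul0r !oppr0 !expR0 !mulr1.
rewrite integral_lebesgue_rV_cons; last exact: integrable_cos_gaussian.
set c := gauss1_mass s ^+ d * expR (- (dotp (rV_uncons xi).2 (rV_uncons xi).2 / (4 * s))).
transitivity (\int[lebesgue_measure]_a (c%:E * (cos (th + (rV_uncons xi).1 * (a - (rV_uncons m).1))
    * gauss1 s (rV_uncons m).1 a)%:E))%E.
  apply: eq_integral => a _.
  transitivity (\int[lebesgue_rV d]_x ((gauss1 s (rV_uncons m).1 a)%:E *
      (cos ((th + (rV_uncons xi).1 * (a - (rV_uncons m).1)) +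
          dotp (rV_uncons xi).2 (x - (rV_uncons m).2)) *
        gaussian s (rV_uncons m).2 x)%:E))%E.
    apply: eq_integral => x _; rewrite gaussian_cons rV_cons_sub dotp_cons -EFinM.
    by rewrite /= addrA mulrCA.
  rewrite integralZl//; last exact: integrable_cos_gaussian.
  by rewrite IH -!EFinM -/c; congr EFin; ring.
have ig : lebesgue_measure.-integrable setT (fun a : R =>
    (cos (th + (rV_uncons xi).1 * (a - (rV_uncons m).1)) * gauss1 s (rV_uncons m).1 a)%:E).
  apply: integrable_mul_gauss1 => //; first exact: measurable_cos_affine.
  by move=> x; exact: normr_cos_le1.
rewrite integralZl//.
rewrite -[X in (_ * X)%E]fineK; last exact: integrable_fin_num.
rewrite -EFinM [fine _](Rintegral_cos_gauss1 (rV_uncons m).1 th (rV_uncons xi).1 s0).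
rewrite (dotp_uncons xi xi) -expr2 (mulrDl (_ ^+ 2)) opprD expRD /c (exprSr (gauss1_mass s)).
by congr EFin; ring.
Qed.

End gaussian_integral.

(** * Gaussian energies of a positive-definite weight are maximal at the origin *)

Lemma le_of_eq disp (T : porderType disp) (x y : T) : x = y -> (x <= y)%O.
Proof. by move->. Qed.

Lemma le_fin_num (R : realType) (a b : \bar R) : a \is a fin_num ->
  b \is a fin_num -> fine a <= fine b -> (a <= b)%E.
Proof.
by move=> ? ? ab; rewrite -(fineK (x := a))// -(fineK (x := b))// lee_fin.
Qed.

Section tempered_gaussian.
Context {R : realType} {d : nat}.
Local Notation leb := (@lebesgue_rV R d).
Implicit Types (g f w : 'rV[R]_d -> \bar R) (s : R) (m xi x : 'rV[R]_d).

Lemma integrable_tempered_gaussian g s m : tempered g -> 0 < s ->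
  leb.-integrable setT (fun x => (g x * (gaussian s m x)%:E)%E).
Proof.
move=> [mg [l l0 gl]] s0.
(* The tempered exponent is real; rounding it up to a natural number makes the polynomial bound on
   the Gaussian applicable. *)
have [k lk] : exists k : nat, l <= k%:R.
  by exists (Num.bound l); rewrite ltW// archi_boundP// ltW.
have [C C0 hC] := polynomial_gaussian_bounded m k s0.
have mweight : measurable_fun setT (fun x => ((1 + enorm x ^+ 2) `^ (- l))%:E).
  apply/measurable_EFinP.
  rewrite (_ : (fun _ => _) = (fun y => y `^ (- l)) \o (fun x => 1 + dotp x x)).
    apply: measurableT_comp; first exact: measurable_powR.
    by apply: measurable_funD => //; apply: measurable_dotp.
  by apply/funext => x; rewrite /= enorm_sqr.
have ig : leb.-integrable setT
    (fun x => (C%:E * (((1 + enorm x ^+ 2) `^ (- l))%:E * `|g x|))%E).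
  apply: integrableZl => //; apply/integrableP; split.
    by apply: emeasurable_funM => //; exact: measurableT_comp.
  under eq_integral do rewrite abseM abse_id /= ger0_norm ?powR_ge0//.
  exact: gl.
apply: (le_integrable measurableT _ _ ig).
  apply: emeasurable_funM => //; apply/measurable_EFinP.
  exact: measurable_gaussian.
move=> x _; rewrite !abseM abse_id muleA muleC; apply: lee_wpmul2r => //.
rewrite /= -EFinM lee_fin !ger0_norm ?expR_ge0 ?powR_ge0//.
rewrite powRN ler_pdivlMr ?powR_gt0 ?enorm_sqr//; last first.
  by rewrite ltr_pwDl// dotp_ge0.
apply: le_trans (hC x); rewrite mulrC ler_wpM2r ?expR_ge0//.
rewrite -powR_mulrn ?addr_ge0 ?dotp_ge0//.
by rewrite ler_powR// lerDl dotp_ge0.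
Qed.

Lemma Re_fourier_gaussian s m xi : 0 < s ->
  complex.Re (fourier (fun x => (gaussian s m x)%:C%C) xi) =
  cos (dotp xi m) * (gauss1_mass s ^+ d * gaussian (4 * s)^-1 0 xi).
Proof.
move=> s0; rewrite /fourier /cintegral /=.
(* The phase - xi.x is split as - xi.m - xi.(x - m), so the constant phase carries all the
   dependence on the centre. *)
have := integral_cos_gaussian (- dotp xi m) (- xi) m s0.
have dN (y : 'rV[R]_d) : dotp (- xi) y = - dotp xi y.
  by rewrite /dotp -sumrN; apply: eq_bigr => i _; rewrite mxE mulNr.
move/(congr1 fine); rewrite cosN /gaussian subr0 /=.
have -> : dotp (- xi) (- xi) / (4 * s) = (4 * s)^-1 * dotp xi xi.
  by rewrite mulrC; congr (_ * _); apply: eq_bigr => i _; rewrite !mxE mulrNN.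
move=> <-; rewrite /Rintegral; congr fine; apply: eq_integral => x _.
rewrite /= mulr0 subr0; congr (cos _ * _)%:E.
rewrite dN.
have -> : dotp xi (x - m) = dotp xi x - dotp xi m.
  by rewrite /dotp -sumrB; apply: eq_bigr => i _; rewrite !mxE mulrBr.
by ring.
Qed.

Lemma Re_dist_of_efun g phi :
  complex.Re (dist_of_efun g phi) =
  fine (\int[leb]_x (g x * (complex.Re (phi x))%:E))%E.
Proof. by []. Qed.

Lemma gaussian_energy_max w f s m :
  tempered w -> tempered f -> (forall x, 0 <= f x)%E ->
  eq_tempered_dist (dist_of_efun w) (fourier_dist (dist_of_efun f)) ->
  0 < s ->
  (\int[leb]_x (w x * (gaussian s m x)%:E) <=
   \int[leb]_x (w x * (gaussian s 0 x)%:E))%E.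
Proof.
move=> tw tf f0 wf s0.
have s40 : 0 < (4 * s)^-1 by rewrite invr_gt0 mulr_gt0.
have energyE m' : fine (\int[leb]_x (w x * (gaussian s m' x)%:E))%E =
    fine (\int[leb]_x (f x * (cos (dotp x m') *
      (gauss1_mass s ^+ d * gaussian (4 * s)^-1 0 x))%:E))%E.
  have E := wf _ (schwartz_gaussian m' s0).
  have Ew := Re_dist_of_efun w (fun x => (gaussian s m' x)%:C%C).
  have Ef := Re_dist_of_efun f (fourier (fun x => (gaussian s m' x)%:C%C)).
  rewrite E {}/fourier_dist Ef in Ew.
  apply: (etrans (esym Ew)).
  by congr fine; apply: eq_integral => x _; rewrite Re_fourier_gaussian.
have c0 : 0 <= gauss1_mass s ^+ d by rewrite exprn_ge0// gauss1_mass_ge0.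
have ifG : leb.-integrable setT (fun x =>
    (f x * (gauss1_mass s ^+ d * gaussian (4 * s)^-1 0 x)%:E)%E).
  under eq_fun do rewrite EFinM muleCA.
  by apply: integrableZl => //; exact: integrable_tempered_gaussian.
have ifcG m' : leb.-integrable setT (fun x => (f x * (cos (dotp x m') *
      (gauss1_mass s ^+ d * gaussian (4 * s)^-1 0 x))%:E)%E).
  apply: (le_integrable measurableT _ _ ifG).
    apply: emeasurable_funM; first exact: tf.1.
    apply/measurable_EFinP; apply: measurable_funM.
      apply: (measurableT_comp (f := cos)).
        by apply: continuous_measurable_fun; exact: continuous_cos.
      exact: measurable_dotp.
    by apply: measurable_funM => //; exact: measurable_gaussian.
  move=> x _; rewrite !abseM; apply: lee_wpmul2l => //=.
  rewrite lee_fin normrM ler_piMl// normr_cos_le1//.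
have fin g : leb.-integrable setT g -> (\int[leb]_x g x)%E \is a fin_num.
  by move=> ig; exact: integrable_fin_num.
(* The distributional identity equates the integrals only through [fine], which sends infinite
   values to 0. Temperedness against a Gaussian makes both integrals finite, so the comparison lifts
   back to the extended reals. *)
apply: le_fin_num.
- by apply: fin; exact: integrable_tempered_gaussian.
- by apply: fin; exact: integrable_tempered_gaussian.
(* rewriting with energyE would try to unify the Gaussians centred at m and 0
   by unfolding expR *)
apply: le_trans (le_trans (le_of_eq (energyE m)) _) (le_of_eq (esym (energyE 0))).
apply: fine_le; [exact: (fin _ (ifcG m))|exact: (fin _ (ifcG 0))|].
apply: le_integral => // x _.
apply: lee_wpmul2l => //; rewrite lee_fin.
have -> : dotp x 0 = 0 by rewrite /dotp big1// => i _; rewrite mxE mulr0.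
by rewrite cos0 ler_wpM2r ?mulr_ge0 ?expR_ge0// cos_le1.
Qed.

End tempered_gaussian.

(** * Integration against a measure given by a density *)

Section integral_density.
Local Open Scope ereal_scope.
Context dd (T : measurableType dd) (R : realType).
Variables (mu : {measure set T -> \bar R}) (w : T -> R).
Hypotheses (mw : measurable_fun setT w) (w0 : forall x, (0 <= w x)%R).
Import HBNNSimple.

Let nu A := \int[mu]_(x in A) (w x)%:E.

Let nu0 : nu set0 = 0. Proof. exact: integral_set0. Qed.

Let nu_ge0 A : 0 <= nu A.
Proof. by apply: integral_ge0 => x _; rewrite lee_fin. Qed.

Let nu_sigma_additive : semi_sigma_additive nu.
Proof.
move=> F mF tF mUF; rewrite /nu ge0_integral_bigcup//.
- by apply: is_cvg_ereal_nneg_natsum_cond => n _ _; exact: nu_ge0.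
- by apply/measurable_EFinP; exact: measurable_funTS.
- by move=> x _; rewrite lee_fin.
Qed.

HB.instance Definition _ := isMeasure.Build _ _ _ nu nu0 nu_ge0 nu_sigma_additive.

(** Both sides are the finite sum, over the values r of [h], of r times the integral of [w] over the
    level set of r. *)
Let integral_density_nnsfun (h : {nnsfun T >-> R}) :
  \int[nu]_x (h x)%:E = \int[mu]_x ((h x)%:E * (w x)%:E).
Proof.
have mEw : measurable_fun setT (EFin \o w) by exact/measurable_EFinP.
have mi (r : R) : measurable_fun setT (fun x => (\1_(h @^-1` [set r]) x * w x)%:E).
  by apply/measurable_EFinP; apply: measurable_funM.
rewrite integralT_nnsfun sintegralE.
transitivity (\int[mu]_x \sum_(r \in range h)
    (r%:E * (\1_(h @^-1` [set r]) x * w x)%:E)); last first.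
  apply: eq_integral => x _; rewrite -EFinM.
  under eq_fsbigr do rewrite -EFinM.
  rewrite fsumEFin//; congr EFin; rewrite [in RHS](fimfunE h x) mulr_fsuml.
  by apply: eq_fsbigr => r _; rewrite mulrA.
have r0 r : (r \in range h) -> 0 <= r%:E.
  by rewrite inE => -[x _ <-]; rewrite lee_fin.
have i0 r x : 0 <= (\1_(h @^-1` [set r]) x * w x)%:E by rewrite lee_fin mulr_ge0.
rewrite ge0_integral_fsum//; last 2 first.
- move=> r; apply: emeasurable_funM => //; exact: mi.
- move=> r x _; rewrite -EFinM mulrA lee_fin mulr_ge0//.
  by have := nnfun_muleindic_ge0 h r x; rewrite lee_fin.
apply: eq_fsbigr => r rh; rewrite ge0_integralZl//; last exact: r0.
congr (_ * _); rewrite /nu [LHS]integral_mkcond; apply: eq_integral => x _.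
by rewrite patchE indicE; case: ifPn => _; rewrite ?mul1r ?mul0r.
Qed.

(** The set function is spelled out because [spectral_measure] is a bare set function of this shape;
    inside the proof it is convertible to [nu], which carries the measure structure that monotone
    convergence uses. *)
Lemma ge0_integral_density (g : T -> \bar R) :
  measurable_fun setT g -> (forall x, 0 <= g x) ->
  \int[fun A => \int[mu]_(x in A) (w x)%:E]_x g x = \int[mu]_x (g x * (w x)%:E).
Proof.
move=> mg g0; pose h := nnsfun_approx measurableT mg.
have gE x : g x = limn (fun n => (h n x)%:E).
  by apply/esym/cvg_lim => //; exact: cvg_nnsfun_approx.
transitivity (\int[nu]_x limn (fun n => (h n x)%:E)).
  by rewrite -(funext gE).
rewrite monotone_convergence//; last 3 first.
- by move=> n; exact/measurable_EFinP.
- by move=> n x _; rewrite lee_fin.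
- by move=> x _ a b ab; rewrite lee_fin; exact/lefP/nd_nnsfun_approx.
rewrite (funext (fun n => integral_density_nnsfun (h n))).
rewrite -monotone_convergence//.
- apply: eq_integral => x _; apply/cvg_lim => //.
  by apply: cvgeZr => //; exact: cvg_nnsfun_approx.
- by move=> n; apply: emeasurable_funM; exact/measurable_EFinP.
- by move=> n x _; rewrite -EFinM lee_fin mulr_ge0.
- move=> x _ a b ab; rewrite -!EFinM lee_fin ler_wpM2r//.
  exact/lefP/nd_nnsfun_approx.
Qed.

End integral_density.
(* Unlike the library's ge0_le_integral, requires no measurability: the supremum
   over eta is not known to be measurable in t. *)
Lemma ge0_subset_le_integral dd (T : measurableType dd) (R : realType)
    (mu : {measure set T -> \bar R}) (D E : set T) (f g : T -> \bar R) :
  D `<=` E -> (forall x, D x -> 0 <= f x)%E -> (forall x, E x -> 0 <= g x)%E ->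
  (forall x, D x -> f x <= g x)%E ->
  (\int[mu]_(x in D) f x <= \int[mu]_(x in E) g x)%E.
Proof.
move=> DE f0 g0 fg; rewrite !(integral_mkcond _ f) !(integral_mkcond _ g).
rewrite !ge0_integralTE; last 2 first.
- exact: erestrict_ge0.
- exact: erestrict_ge0.
apply: le_ereal_sup => _ [h hf <-]; exists h => // x.
apply: (le_trans (hf x)); rewrite !patchE.
case: ifPn => [/set_mem Dx|_]; first by rewrite mem_set ?fg//; exact: DE.
by case: ifPn => // /set_mem; exact: g0.
Qed.

(** On nonnegative reals inversion is the power function of exponent -1; at 0 both take the default
    value 0. *)
Lemma measurable_invr_ge0 dd (T : measurableType dd) (R : realType) (D : set T)
    (u : T -> R) : measurable_fun D u -> (forall x, 0 <= u x) ->
  measurable_fun D (fun x => (u x)^-1).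
Proof.
move=> mu u0; rewrite (_ : (fun _ => _) = (fun y => y `^ (-1)) \o u).
  by apply: (measurableT_comp _ mu); exact: measurable_powR.
apply/funext => x /=; have [->|ux] := eqVneq (u x) 0.
  by rewrite invr0 powR0// oppr_eq0 oner_eq0.
by rewrite powR_inv1.
Qed.

(** * The resolvent as an exponential mixture of Gaussians *)

Section laplace.
Context {R : realType}.
Local Notation leb := (@lebesgue_measure R).

(** Tilting the rate-1 exponential density by exp(- s r) gives (1 + r)^-1 times the density of rate
    1 + r, whose mass is 1. The density vanishes for s < 0, so the integral may run over the whole
    line. *)
Lemma integral_exp_laplace (r : R) : 0 <= r ->
  (\int[leb]_s (exponential_pdf 1 s * expR (- (s * r)))%:E = ((1 + r)^-1)%:E)%E.
Proof.
move=> r0; have r1 : 0 < 1 + r by rewrite ltr_pwDl.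
transitivity (\int[leb]_s (((1 + r)^-1)%:E * (exponential_pdf (1 + r) s)%:E))%E.
  apply: eq_integral => s _; rewrite -EFinM; congr EFin.
  have [s0|s0] := ltP s 0; first by rewrite !lt0_exponential_pdf// mul0r mulr0.
  rewrite !exponential_pdfE// mul1r mulKf ?gt_eqF// -expRD; congr expR; ring.
rewrite ge0_integralZl//.
- by rewrite integral_exponential_pdf ?mule1.
- by apply/measurable_EFinP; exact: measurable_exponential_pdf.
- by move=> s _; rewrite lee_fin exponential_pdf_ge0// ltW.
- by rewrite lee_fin invr_ge0 ltW.
Qed.

Context dd (T : measurableType dd) (mu : {sigma_finite_measure set T -> \bar R}).
Variables (a W : T -> R).
Hypotheses (ma : measurable_fun setT a) (a0 : forall x, 0 <= a x).
Hypotheses (mW : measurable_fun setT W) (W0 : forall x, 0 <= W x).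

Let F (p : R * T) : \bar R :=
  (exponential_pdf 1 p.1 * (W p.2 * expR (- (p.1 * a p.2))))%:E.

Let F0 p : (0 <= F p)%E.
Proof. by rewrite lee_fin !mulr_ge0 ?expR_ge0 ?exponential_pdf_ge0. Qed.

Let mF : measurable_fun setT F.
Proof.
apply/measurable_EFinP; apply: measurable_funM.
  by apply: measurableT_comp; [exact: measurable_exponential_pdf|exact: measurable_fst].
apply: measurable_funM; first exact: measurableT_comp mW measurable_snd.
apply: measurableT_comp => //; apply: measurable_funN; apply: measurable_funM => //.
exact: measurableT_comp ma measurable_snd.
Qed.

Let mlaplace s : measurable_fun setT (fun x => (W x * expR (- (s * a x)))%:E).
Proof.
apply/measurable_EFinP; apply: measurable_funM => //.
by apply: measurableT_comp => //; apply: measurable_funN; exact: measurable_funM.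
Qed.

Let F_laplace s : (\int[mu]_x F (s, x) =
  (exponential_pdf 1 s)%:E * \int[mu]_x (W x * expR (- (s * a x)))%:E)%E.
Proof.
rewrite /F/=; under eq_integral do rewrite EFinM.
rewrite ge0_integralZl// ?lee_fin ?exponential_pdf_ge0//.
by move=> x _; rewrite lee_fin mulr_ge0 ?expR_ge0.
Qed.

Lemma measurable_laplace : measurable_fun [set: R] (fun s =>
  (exponential_pdf 1 s)%:E * \int[mu]_x (W x * expR (- (s * a x)))%:E)%E.
Proof.
rewrite -(funext F_laplace).
exact: (@measurable_fun_fubini_tonelli_F _ _ (measurableTypeR R) T R mu F).
Qed.

Lemma resolvent_laplace :
  (\int[mu]_x (W x * (1 + a x)^-1)%:E = \int[leb]_s ((exponential_pdf 1 s)%:E *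
     \int[mu]_x (W x * expR (- (s * a x)))%:E))%E.
Proof.
under [RHS]eq_integral do rewrite -F_laplace.
rewrite (@fubini_tonelli _ _ (measurableTypeR R) T R leb mu F)//.
apply: eq_integral => x _; rewrite EFinM -integral_exp_laplace//.
rewrite -ge0_integralZl ?lee_fin//.
- by apply: eq_integral => s _; rewrite /F/= -EFinM mulrCA.
- apply/measurable_EFinP; apply: measurable_funM; first exact: measurable_exponential_pdf.
  apply: measurableT_comp => //; apply: measurable_funN; exact: measurable_funM.
- by move=> s _; rewrite lee_fin mulr_ge0 ?expR_ge0 ?exponential_pdf_ge0.
Qed.

End laplace.

(** * Measurability and pointwise bounds of the heat and wave symbols *)

Lemma measurable_enorm (R : realType) d : measurable_fun setT (@enorm R d).
Proof.
apply: (@measurableT_comp _ _ _ _ _ _ (@Num.sqrt R) _ (fun x => dotp x x)).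
  by apply: continuous_measurable_fun; exact: sqrt_continuous.
exact: measurable_dotp.
Qed.

Lemma enorm_eq0 (R : realType) d (x : 'rV[R]_d) : (enorm x == 0) = (x == 0).
Proof.
apply/eqP/eqP => [x0|->]; last first.
  by rewrite /enorm /dotp big1 ?sqrtr0// => i _; rewrite mxE mulr0.
have /eqP : dotp x x = 0 by rewrite -enorm_sqr x0 expr0n.
rewrite psumr_eq0; last by move=> i _; rewrite -expr2 sqr_ge0.
move=> /allP h; apply/rowP => i; rewrite mxE.
have := h i; rewrite mem_index_enum -expr2 sqrf_eq0 => /(_ isT)/eqP.
exact.
Qed.

Lemma normr_sin_le (R : realType) (x : R) : `|sin x| <= `|x|.
Proof.
wlog x0 : x / 0 <= x.
  move=> H; have [/H//|/ltW x0] := leP 0 x.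
  by rewrite -normrN -sinN -[leRHS]normrN; apply: H; rewrite oppr_ge0.
have [|c _ +] := @MVT_segment R sin cos 0 x x0 (fun y _ => is_derive_sin y).
  by apply: continuous_subspaceT => y; exact: continuous_sin.
rewrite sin0 !subr0 => ->; rewrite normrM ler_piMl// normr_cos_le1//.
Qed.

Section symbol.
Context {R : realType} {d : nat}.
Implicit Types (t : R) (xi : 'rV[R]_d).

Lemma measurable_fundamental_solution_fourier op :
  measurable_fun setT (fun p : R * 'rV[R]_d =>
    fundamental_solution_fourier op p.1 p.2).
Proof.
have me : measurable_fun setT (fun p : R * 'rV[R]_d => enorm p.2).
  exact: measurableT_comp (@measurable_enorm R d) measurable_snd.
case: op => /=.
  apply: measurableT_comp => //; apply: measurable_funN.
  apply: measurable_funM => //; apply: measurable_funM => //.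
  exact: measurable_funX.
(* The test on the vector becomes a test on its norm, an equality between measurable real
   functions. *)
rewrite (_ : (fun _ => _) = (fun p : R * 'rV[R]_d => if enorm p.2 == 0 then p.1
    else sin (p.1 * enorm p.2) * (enorm p.2)^-1)); last first.
  by apply/funext => p; rewrite enorm_eq0.
apply: measurable_fun_ifT.
- exact: measurable_fun_eqr.
- exact: measurable_fst.
- apply: measurable_funM.
    apply: (measurableT_comp (f := sin)); last exact: measurable_funM.
    by apply: continuous_measurable_fun; exact: continuous_sin.
  by apply: measurable_invr_ge0 => // p; exact: sqrtr_ge0.
Qed.

Lemma measurable_fundamental_solution_fourier_sqr op t (eta : 'rV[R]_d) :
  measurable_fun setT (fun xi : 'rV[R]_d =>
    `|fundamental_solution_fourier op t (xi + eta)| ^+ 2).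
Proof.
apply: measurable_funX; apply: measurableT_comp => //.
apply: (measurableT_comp (measurable_fundamental_solution_fourier op)
  (g := fun xi => (t, xi + eta))).
by apply: measurable_fun_pair => //; exact: measurable_addr_rV.
Qed.

Lemma heat_symbol_sqr t xi :
  `|fundamental_solution_fourier heat t xi| ^+ 2 = expR (- (t * dotp xi xi)).
Proof.
rewrite /= ger0_norm ?expR_ge0// -expRM_natr enorm_sqr; congr expR.
by field.
Qed.

(** Multiplied by 1 + |xi|^2, the squared symbol is sin^2 / |xi|^2 + sin^2 for xi nonzero; |sin y|
    <= |y| bounds the first term by t^2, and the second is at most 1. *)
Lemma wave_symbol_sqr_le t xi :
  `|fundamental_solution_fourier wave t xi| ^+ 2 <=
  (1 + t ^+ 2) * (1 + dotp xi xi)^-1.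
Proof.
have q1 : 0 < 1 + dotp xi xi by rewrite ltr_pwDl// dotp_ge0.
rewrite ler_pdivlMr//= real_normK ?num_real//.
case: ifPn => [/eqP ->|x0].
  rewrite /dotp big1 => [|i _]; first by rewrite addr0 mulr1 lerDr.
  by rewrite mxE mul0r.
have e0 : 0 < enorm xi by rewrite lt_neqAle eq_sym enorm_eq0 x0 sqrtr_ge0.
have s1 : sin (t * enorm xi) ^+ 2 <= 1.
  by rewrite -real_normK ?num_real// expr_le1 ?normr_sin_le1.
have st : sin (t * enorm xi) ^+ 2 <= t ^+ 2 * enorm xi ^+ 2.
  rewrite -exprMn -(real_normK (num_real (sin _))) -(real_normK (num_real (t * _))).
  by rewrite lerXn2r ?nnegrE// normr_sin_le.
rewrite -enorm_sqr expr_div_n mulrDr mulr1 divfK ?expf_eq0/= ?gt_eqF//.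
by rewrite addrC lerD// ler_pdivrMr// exprn_gt0.
Qed.

(** With r = |xi|^2, exp(t r) >= 1 + t r and (1 + 1/t) (1 + t r) >= 1 + r. *)
Lemma heat_symbol_le t xi : 0 < t ->
  expR (- (t * dotp xi xi)) <= (1 + t^-1) * (1 + dotp xi xi)^-1.
Proof.
move=> t0; have q0 := dotp_ge0 xi.
have q1 : 0 < 1 + dotp xi xi by rewrite ltr_pwDl.
rewrite expRN -[leLHS]mul1r ler_pdivrMr ?expR_gt0// mulrAC ler_pdivlMr// mul1r.
apply: (@le_trans _ _ ((1 + t^-1) * (1 + t * dotp xi xi))); last first.
  by rewrite ler_wpM2l ?expR_ge1Dx// addr_ge0// invr_ge0 ltW.
have ti : t^-1 * t = 1 by rewrite mulVf// gt_eqF.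
have ti0 : 0 < t^-1 by rewrite invr_gt0.
have := mulr_ge0 (ltW t0) q0; nra.
Qed.

End symbol.

(** * Energy bounds for the spectral measure, and the conclusion *)

Section spectral.
Context {R : realType} {d : nat} (h : 'rV[R]_d -> R[i]) (f : 'rV[R]_d -> \bar R).
Local Notation leb := (@lebesgue_rV R d).
Local Notation h2 := (fun xi => (ComplexField.Normc.normc (h xi) ^+ 2)%:E).
Hypothesis h2_tempered : tempered h2.
Hypothesis f_ge0 : forall x, (0 <= f x)%E.
Hypothesis f_tempered : tempered f.
Hypothesis fourier_f : eq_tempered_dist (dist_of_efun h2)
  (fourier_dist (dist_of_efun f)).

Let W xi : R := (2 * pi) ^- d * ComplexField.Normc.normc (h xi) ^+ 2.

Let c0 : 0 <= (2 * pi : R) ^- d.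
Proof. by rewrite invr_ge0 exprn_ge0// mulr_ge0// pi_ge0. Qed.

Let W0 xi : 0 <= W xi.
Proof. by rewrite mulr_ge0// sqr_ge0. Qed.

Let mW : measurable_fun setT W.
Proof.
by apply: measurable_funM => //; apply/measurable_EFinP; exact: h2_tempered.1.
Qed.

Let ma (m : 'rV[R]_d) : measurable_fun setT (fun x : 'rV[R]_d => dotp (x - m) (x - m)).
Proof. by apply: measurable_dotp; exact: (measurable_addr_rV (- m)). Qed.

Lemma integral_spectral_measure (u : 'rV[R]_d -> R) :
  measurable_fun setT u -> (forall x, 0 <= u x) ->
  (\int[spectral_measure h]_x (u x)%:E = \int[leb]_x (W x * u x)%:E)%E.
Proof.
move=> mu u0; transitivity (\int[leb]_x ((u x)%:E * (W x)%:E))%E.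
  apply: (ge0_integral_density leb mW W0) => [|x]; last by rewrite lee_fin.
  exact/measurable_EFinP.
by apply: eq_integral => x _; rewrite -EFinM mulrC.
Qed.

Lemma heat_energy_shift_le (s : R) (m : 'rV[R]_d) : 0 <= s ->
  (\int[leb]_x (W x * expR (- (s * dotp (x - m) (x - m))))%:E <=
   \int[leb]_x (W x * expR (- (s * dotp x x)))%:E)%E.
Proof.
(* At s = 0 the Gaussian degenerates to the constant 1, which is not a Schwartz function, but there
   both sides are the same integral. *)
rewrite le_eqVlt => /predU1P[<-|s0].
  by under eq_integral do rewrite mul0r; under [leRHS]eq_integral do rewrite mul0r.
have WE n : (\int[leb]_x (W x * gaussian s n x)%:E =
    ((2 * pi) ^- d)%:E * \int[leb]_x (h2 x * (gaussian s n x)%:E))%E.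
  rewrite -ge0_integralZl// ?lee_fin//.
  - by apply: eq_integral => x _; rewrite -!EFinM mulrA.
  - apply: emeasurable_funM; first exact: h2_tempered.1.
    by apply/measurable_EFinP; exact: measurable_gaussian.
  - by move=> x _; rewrite -EFinM lee_fin mulr_ge0 ?sqr_ge0 ?expR_ge0.
apply: (le_trans (le_of_eq (WE m))).
apply: (le_trans (lee_wpmul2l _ (gaussian_energy_max m h2_tempered f_tempered f_ge0 fourier_f s0))).
  by rewrite lee_fin.
apply: (le_trans (le_of_eq (esym (WE 0)))).
by apply: le_of_eq; apply: eq_integral => x _; rewrite /gaussian subr0.
Qed.

Let Dalang := (\int[leb]_x (W x * (1 + dotp x x)^-1)%:E)%E.

Lemma resolvent_energy_shift_le (m : 'rV[R]_d) :
  (\int[leb]_x (W x * (1 + dotp (x - m) (x - m))^-1)%:E <= Dalang)%E.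
Proof.
have a0 n (x : 'rV[R]_d) : 0 <= dotp (x - n) (x - n) by exact: dotp_ge0.
have m0 : measurable_fun setT (fun x : 'rV[R]_d => dotp x x).
  exact: measurable_dotp.
have lap := @resolvent_laplace R _ _ leb.
rewrite /Dalang (lap _ _ (ma m) (a0 m) mW W0).
rewrite (lap _ _ m0 (@dotp_ge0 R d) mW W0).
apply: ge0_subset_le_integral => // s _.
- apply: mule_ge0; first by rewrite lee_fin exponential_pdf_ge0.
  by apply: integral_ge0 => x _; rewrite lee_fin mulr_ge0 ?expR_ge0.
- apply: mule_ge0; first by rewrite lee_fin exponential_pdf_ge0.
  by apply: integral_ge0 => x _; rewrite lee_fin mulr_ge0 ?expR_ge0.
have [s0|s0] := ltP s 0; first by rewrite lt0_exponential_pdf// !mul0e.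
apply: lee_wpmul2l; first by rewrite lee_fin exponential_pdf_ge0.
exact: heat_energy_shift_le.
Qed.

Lemma sup_shifted_energy_le op (t : R) (B : \bar R) :
  (forall m : 'rV[R]_d, \int[leb]_x
    (W x * `|fundamental_solution_fourier op t (x - m)| ^+ 2)%:E <= B)%E ->
  (sup_shifted_energy op (spectral_measure h) t <= B)%E.
Proof.
move=> HB; apply: ge_ereal_sup => _ [eta _ <-].
rewrite integral_spectral_measure.
- by apply: le_trans (HB (- eta)); rewrite opprK.
- exact: measurable_fundamental_solution_fourier_sqr.
- by move=> x; exact: sqr_ge0.
Qed.

Lemma heat_sup_le (t : R) : 0 <= t ->
  (sup_shifted_energy heat (spectral_measure h) t <=
   \int[leb]_x (W x * expR (- (t * dotp x x)))%:E)%E.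
Proof.
move=> t0; apply: sup_shifted_energy_le => m.
under eq_integral do rewrite heat_symbol_sqr.
exact: heat_energy_shift_le.
Qed.

Let integral_resolventZ (k : R) (m : 'rV[R]_d) : 0 <= k ->
  (\int[leb]_x (W x * (k * (1 + dotp (x - m) (x - m))^-1))%:E =
   k%:E * \int[leb]_x (W x * (1 + dotp (x - m) (x - m))^-1)%:E)%E.
Proof.
move=> k0; rewrite -ge0_integralZl// ?lee_fin//.
- by apply: eq_integral => x _; rewrite -EFinM mulrCA.
- apply/measurable_EFinP; apply: measurable_funM => //.
  apply: measurable_invr_ge0 => [|x]; last by rewrite addr_ge0// dotp_ge0.
  by apply: measurable_funD => //; exact: ma.
- by move=> x _; rewrite lee_fin mulr_ge0// invr_ge0 addr_ge0// dotp_ge0.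
Qed.

Lemma wave_sup_le (t : R) :
  (sup_shifted_energy wave (spectral_measure h) t <= (1 + t ^+ 2)%:E * Dalang)%E.
Proof.
have t1 : 0 <= 1 + t ^+ 2 by rewrite addr_ge0// sqr_ge0.
apply: sup_shifted_energy_le => m.
apply: (@le_trans _ _ (\int[leb]_x
    (W x * ((1 + t ^+ 2) * (1 + dotp (x - m) (x - m))^-1))%:E)%E).
  apply: ge0_subset_le_integral => // x _; rewrite lee_fin.
  - by rewrite mulr_ge0// sqr_ge0.
  - by rewrite mulr_ge0// mulr_ge0// invr_ge0 addr_ge0// dotp_ge0.
  - by rewrite ler_wpM2l// wave_symbol_sqr_le.
rewrite integral_resolventZ//; apply: lee_wpmul2l; first by rewrite lee_fin.
exact: resolvent_energy_shift_le.
Qed.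

Lemma heat_energy_le (t : R) : 0 < t ->
  (\int[leb]_x (W x * expR (- (t * dotp x x)))%:E <= (1 + t^-1)%:E * Dalang)%E.
Proof.
move=> t0; have t1 : 0 <= 1 + t^-1 by rewrite addr_ge0// invr_ge0 ltW.
have := integral_resolventZ 0 t1.
under eq_integral do rewrite subr0.
under [X in _ = (_ * X)%E -> _]eq_integral do rewrite subr0.
move=> <-; apply: ge0_subset_le_integral => // x _; rewrite lee_fin.
- by rewrite mulr_ge0// expR_ge0.
- by rewrite mulr_ge0// mulr_ge0// invr_ge0 addr_ge0// dotp_ge0.
- by rewrite ler_wpM2l// heat_symbol_le.
Qed.

Lemma heat_time_integral_le (T : R) :
  (\int[lebesgue_measure]_(t in `[0%R, T])
     \int[leb]_x (W x * expR (- (t * dotp x x)))%:E <= (expR T)%:E * Dalang)%E.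
Proof.
have m0 : measurable_fun setT (fun x : 'rV[R]_d => dotp x x).
  exact: measurable_dotp.
have E0 (t : R) : (0 <= \int[leb]_x (W x * expR (- (t * dotp x x)))%:E)%E.
  by apply: integral_ge0 => x _; rewrite lee_fin mulr_ge0 ?expR_ge0.
have P0 (t : R) : (0 <= (exponential_pdf 1 t)%:E *
    \int[leb]_x (W x * expR (- (t * dotp x x)))%:E)%E.
  by apply: mule_ge0 => //; rewrite lee_fin exponential_pdf_ge0.
(* Dalang's integral becomes a mixture of the heat energies over all positive times; discarding the
   times outside [0, T] can only decrease it. *)
rewrite /Dalang (resolvent_laplace leb m0 (@dotp_ge0 R d) mW W0).
rewrite -ge0_integralZl ?lee_fin ?expR_ge0//; last exact: measurable_laplace.
apply: ge0_subset_le_integral => // t.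
- by move=> _; apply: mule_ge0 => //; rewrite lee_fin expR_ge0.
- rewrite /= in_itv/= => /andP[t0 tT].
rewrite muleA -EFinM -[leLHS]mul1e; apply: lee_wpmul2r => //.
rewrite lee_fin exponential_pdfE// mul1r -expRD -[leLHS]expR0 ler_expR.
by rewrite mulN1r subr_ge0.
Qed.

Lemma dalang_energyE :
  (\int[spectral_measure h]_xi ((1 + enorm xi ^+ 2)^-1)%:E = Dalang)%E.
Proof.
have e0 (x : 'rV[R]_d) : 0 <= 1 + enorm x ^+ 2 by rewrite addr_ge0// sqr_ge0.
rewrite integral_spectral_measure.
- by apply: eq_integral => x _; rewrite enorm_sqr.
- apply: measurable_invr_ge0 => //; apply: measurable_funD => //.
  by apply: measurable_funX; exact: measurable_enorm.
- by move=> x; rewrite invr_ge0.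
Qed.

Lemma sup_shifted_energy_ge0 op (t : R) :
  (0 <= sup_shifted_energy op (spectral_measure h) t)%E.
Proof.
apply: (@le_trans _ _ (\int[leb]_x
    (W x * `|fundamental_solution_fourier op t (x + 0)| ^+ 2)%:E)%E).
  by apply: integral_ge0 => x _; rewrite lee_fin mulr_ge0// sqr_ge0.
apply: ereal_sup_ubound; exists 0 => //; apply: integral_spectral_measure.
  exact: measurable_fundamental_solution_fourier_sqr.
by move=> x; exact: sqr_ge0.
Qed.

Hypothesis dalang :
  (\int[spectral_measure h]_xi ((1 + enorm xi ^+ 2)^-1)%:E < +oo)%E.

Let dalang_mul_lty (k : R) : 0 <= k -> (k%:E * Dalang < +oo)%E.
Proof.
move=> k0; apply: lte_mul_pinfty; rewrite ?lee_fin//.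
by rewrite -dalang_energyE.
Qed.

Lemma sup_shifted_energy_lty op (t : R) : 0 < t ->
  (sup_shifted_energy op (spectral_measure h) t < +oo)%E.
Proof.
move=> t0; case: op.
- apply: le_lt_trans (heat_sup_le (ltW t0)) _.
  apply: le_lt_trans (heat_energy_le t0) _.
  by apply: dalang_mul_lty; rewrite addr_ge0// invr_ge0 ltW.
- apply: le_lt_trans (wave_sup_le t) _.
  by apply: dalang_mul_lty; rewrite addr_ge0// sqr_ge0.
Qed.

Lemma integral_sup_shifted_energy_lty op (T : R) : 0 < T ->
  (\int[lebesgue_measure]_(t in `[0%R, T])
     sup_shifted_energy op (spectral_measure h) t < +oo)%E.
Proof.
move=> T0; case: op.
- have E0 (t : R) : (0 <= \int[leb]_x (W x * expR (- (t * dotp x x)))%:E)%E.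
    by apply: integral_ge0 => x _; rewrite lee_fin mulr_ge0 ?expR_ge0.
  apply: le_lt_trans (dalang_mul_lty (expR_ge0 T)).
  apply: le_trans (heat_time_integral_le T).
  apply: ge0_subset_le_integral => // t.
    by move=> _; exact: sup_shifted_energy_ge0.
  by rewrite /= in_itv/= => /andP[t0 _]; exact: heat_sup_le.
- have T1 : 0 <= 1 + T ^+ 2 by rewrite addr_ge0// sqr_ge0.
  have D0 : (0 <= Dalang)%E.
    apply: integral_ge0 => x _; rewrite lee_fin mulr_ge0//.
    by rewrite invr_ge0 addr_ge0// dotp_ge0.
  (* On [0, T] the wave bound is largest at t = T, so the time integral is at most T (1 + T^2) times
     Dalang's integral. *)
  apply: (@le_lt_trans _ _ (\int[lebesgue_measure]_(t in `[0%R, T])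
      ((1 + T ^+ 2)%:E * Dalang))%E).
    apply: ge0_subset_le_integral => // t.
    + by move=> _; exact: sup_shifted_energy_ge0.
    + by move=> _; apply: mule_ge0; rewrite ?lee_fin.
    rewrite /= in_itv/= => /andP[t0 tT]; apply: (le_trans (wave_sup_le t)).
    by apply: lee_wpmul2r => //; rewrite lee_fin lerD2l lerXn2r ?nnegrE// ltW.
  rewrite integral_cst//= lebesgue_measure_itv/= lte_fin T0 oppr0 addr0 muleAC.
  by rewrite -EFinM; apply: dalang_mul_lty; rewrite mulr_ge0// ltW.
Qed.

End spectral.

Theorem lemma4p4 (R : realType) (d : nat) (hd : (1 <= d)%N)
  (kappa : 'rV[R]_d -> \bar R) (h : 'rV[R]_d -> R[i]) (f : 'rV[R]_d -> \bar R)
  (kappa_ge0 : forall x, (0 <= kappa x)%E)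
  (kappa_tempered : tempered kappa)
  (h_tempered : ctempered h)
  (fourier_kappa : eq_tempered_dist
     (fourier_dist (dist_of_efun kappa)) (dist_of_cfun h))
  (h2_tempered : tempered
     (fun xi => (ComplexField.Normc.normc (h xi) ^+ 2)%:E))
  (f_ge0 : forall x, (0 <= f x)%E)
  (f_tempered : tempered f)
  (fourier_f : eq_tempered_dist
     (dist_of_efun (fun xi => (ComplexField.Normc.normc (h xi) ^+ 2)%:E))
     (fourier_dist (dist_of_efun f)))
  (op : evolution_operator)
  (dalang : (\int[spectral_measure h]_xi ((1 + enorm xi ^+ 2)^-1)%:E
     < +oo)%E) :
  (forall t : R, 0 < t ->
     (sup_shifted_energy op (spectral_measure h) t < +oo)%E)
  /\
  (measurable_fun [set p : R * 'rV[R]_d | 0 <= p.1]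
     (fun p : R * 'rV[R]_d => fundamental_solution_fourier op p.1 p.2)
   /\
   forall T : R, 0 < T ->
     (\int[lebesgue_measure]_(t in `[0%R, T])
        sup_shifted_energy op (spectral_measure h) t < +oo)%E).
Proof.
split=> [t t0|]; first exact: sup_shifted_energy_lty fourier_f dalang op t t0.
split; last by move=> T T0; exact: integral_sup_shifted_energy_lty fourier_f dalang op T T0.
apply: measurable_funTS; exact: measurable_fundamental_solution_fourier.
Qed.
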